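(* Let $\hat q,\hat p$ be $n\times n$ parametric matrices and $M$ an invertible $n\times n$ $(\hat q,\hat p)$-Manin matrix over $\mathfrak R$. Let $I=(i_1<\dots<i_k)$ be an increasing multi-index and $J=(j_1,\dots,j_k)$ any multi-index, both with entries in $\{1,\dots,n\}$. Then $$\varepsilon(\hat p,I^c\oplus I^{\tau})\,\mathrm{cdet}_{\hat q}(M)\,\mathrm{cdet}_{\hat p'}((M^{-1})_{IJ})=\varepsilon(\hat q,J^c\oplus J^{\tau})\,\mathrm{cdet}_{\hat q}(M_{J^cI^c}),$$ where, when $J$ has a repeated entry, the right-hand side is understood to be $0$.
   Context: $\mathfrak R$ is an associative unital algebra over $\mathbb C$. A parametric $n\times n$ matrix is a matrix $\hat q=(q_{ij})$ of nonzero complex numbers with $q_{ij}q_{ji}=1$, $q_{ii}=1$; $\hat p'=(p'_{ij})$ with $p'_{ij}=p_{ij}^{-1}$. An $n\times n$ matrix $M$ over $\mathfrak R$ is a $(\hat q,\hat p)$-Manin matrix if $M_{ik}M_{jk}=q_{ji}M_{jk}M_{ik}$ for $i<j$ and all $k$, and $M_{ik}M_{jl}-q_{ji}p_{kl}M_{jl}M_{ik}+p_{kl}M_{il}M_{jk}-q_{ji}M_{jk}M_{il}=0$ for $i<j$, $k<l$. For a multi-index $I$ with distinct entries in $\{1,\dots,n\}$, $I^c$ is the increasing multi-index of elements of $\{1,\dots,n\}$ not in $I$; $I^{\tau}=(i_k,\dots,i_1)$ is the reverse; $\oplus$ is juxtaposition. For a multi-index $I$, $\varepsilon(\hat q,I)=0$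 if two entries coincide, otherwise $\varepsilon(\hat q,I)=\prod_{s<t,\ i_s>i_t}(-q_{i_si_t})$. For increasing $I=(i_1<\dots<i_r)$ and $\sigma\in S_r$, $\varepsilon(\hat q,I,\sigma)=\prod_{s<t,\ \sigma(s)>\sigma(t)}(-q_{i_{\sigma(s)}i_{\sigma(t)}})$. For any matrix $X$, increasing $I$ and any multi-index $J=(j_1,\dots,j_r)$, $\mathrm{cdet}_{\hat q}(X_{IJ})=\sum_{\sigma\in S_r}\varepsilon(\hat q,I,\sigma)X_{i_{\sigma(1)},j_1}\cdots X_{i_{\sigma(r)},j_r}$ (likewise with any parametric matrix in place of $\hat q$); $\mathrm{cdet}_{\hat q}(X)$ is the case $I=J=(1,\dots,n)$. *)

(* Defs.v *)
From HB Require Import structures.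
From mathcomp Require Import all_boot all_order all_algebra all_fingroup.
From mathcomp Require Import Rstruct complex.
Set Implicit Arguments. Unset Strict Implicit. Unset Printing Implicit Defensive.
Import GRing.Theory.
Local Open Scope ring_scope.

Notation CC := (Rdefinitions.R[i]).

Section ManinDefs.
Variable n : nat.

Definition parametric (q : 'M[CC]_n) : Prop :=
  (forall i j, q i j != 0) /\ (forall i j, q i j * q j i = 1) /\ (forall i, q i i = 1).

Definition pinv (p : 'M[CC]_n) : 'M[CC]_n := \matrix_(i, j) (p i j)^-1.

Variable A : algType CC.

Definition manin (q p : 'M[CC]_n) (M : 'M[A]_n) : Prop :=
  (forall (i j k : 'I_n), (i < j)%N ->
      M i k * M j k = q j i *: (M j k * M i k)) /\
  (forall (i j k l : 'I_n), (i < j)%N -> (k < l)%N ->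
      M i k * M j l - (q j i * p k l) *: (M j l * M i k)
      + p k l *: (M i l * M j k) - q j i *: (M j k * M i l) = 0).

(* eps(q, I) for a multi-index I (a sequence of indices):
   0 if two entries coincide, otherwise the product over positions s < t with
   i_s > i_t of (- q_{i_s i_t}).  Written recursively on the sequence. *)
Fixpoint eps (q : 'M[CC]_n) (I : seq 'I_n) : CC :=
  match I with
  | [::] => 1
  | x :: s => (if x \in s then 0 else 1) *
              (\prod_(y <- s | (y < x)%N) (- q x y)) * eps q s
  end.

(* the t-th entry of a multi-index (default irrelevant when t < size I) *)
Definition entry (I : seq 'I_n) (d : 'I_n) (t : nat) : 'I_n := nth d I t.

(* eps(q, I, sigma) for increasing I = (i_1 < ... < i_r) and sigma in S_r,
   with r = size J (I and J have the same length r in every use). *)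
Definition eps_perm (q : 'M[CC]_n) (I J : seq 'I_n) (s : 'S_(size J)) : CC :=
  \prod_(a < size J) \prod_(b < size J | (a < b)%N && (s b < s a)%N)
     (- q (entry I (tnth (in_tuple J) (s a)) (s a))
          (entry I (tnth (in_tuple J) (s b)) (s b))).

(* cdet_q (X_{IJ}) = sum_sigma eps(q,I,sigma) X_{i_sigma(1) j_1} ... X_{i_sigma(r) j_r}
   (ordered product), for increasing I and J of the same length r. *)
Definition cdet (q : 'M[CC]_n) (X : 'M[A]_n) (I J : seq 'I_n) : A :=
  \sum_(s : 'S_(size J)) eps_perm q I s *:
     \prod_(t < size J) X (entry I (tnth (in_tuple J) t) (s t)) (tnth (in_tuple J) t).

Definition compl (I : seq 'I_n) : seq 'I_n := [seq i <- enum 'I_n | i \notin I].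

Definition increasing (I : seq 'I_n) : bool := sorted (fun a b : 'I_n => (a < b)%N) I.

Definition cdet_full (q : 'M[CC]_n) (X : 'M[A]_n) : A := cdet q X (enum 'I_n) (enum 'I_n).

End ManinDefs.

(* Main.v *)
(** Let psi_1, ..., psi_n generate the q-Grassmann algebra with coefficients in A
    (psi_j psi_i = - q_ji psi_i psi_j, the psi_i commuting with A).  The matrix M
    is (q,p)-Manin iff the elements phi_k = sum_i psi_i M_ik satisfy the
    p-Grassmann relations, and inverting M gives psi_j = sum_i phi_i (M^-1)_ij.
    The identity compares two expressions for the coefficient of psi_1 ... psi_n
    in phi_(I^c) psi_(J^tau): expanding phi_(I^c) in the psi's gives the
    right-hand side, expanding psi_(J^tau) in the phi's gives the left-hand side. *)
From HB Require Import structures.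
Require Import Defs.
From mathcomp Require Import all_boot all_order all_algebra all_fingroup.
From mathcomp Require Import Rstruct complex.
Import GRing.Theory.
Local Open Scope ring_scope.

Set Implicit Arguments.
Unset Strict Implicit.
Unset Printing Implicit Defensive.

(** * Sums over tuples and over pairs of indices *)

Lemma big_tuple_cons (R : Type) (idx : R) (op : Monoid.com_law idx)
    (T : finType) (r : nat) (F : seq T -> R) :
  \big[op/idx]_(u : r.+1.-tuple T) F u =
  \big[op/idx]_(i : T) \big[op/idx]_(u : r.-tuple T) F (i :: u).
Proof.
rewrite pair_big /= (reindex (fun x : T * r.-tuple T => [tuple of x.1 :: x.2])) //=.
exists (fun u : r.+1.-tuple T => (thead u, [tuple of behead u])).
  by move=> [i u] _ /=; congr (_, _); apply/val_inj.
by move=> u _; rewrite -tuple_eta.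
Qed.

Lemma big_tuple0 (R : Type) (idx : R) (op : Monoid.com_law idx)
    (T : finType) (F : seq T -> R) :
  \big[op/idx]_(u : 0.-tuple T) F u = F [::].
Proof.
rewrite (eq_bigr (fun=> F [::])) => [|u _]; last by rewrite tuple0.
by rewrite big_const card_tuple expn0 /= Monoid.mulm1.
Qed.

Lemma sum_antidiag (V : zmodType) (n : nat) (B : 'I_n -> 'I_n -> V) :
  (forall i, B i i = 0) ->
  \sum_j \sum_i B j i =
  \sum_(j < n) \sum_(i < n | (i < j)%N) (B j i + B i j).
Proof.
move=> B0.
have -> : \sum_j \sum_i B j i =
    \sum_(j < n) \sum_(i < n | (i < j)%N) B j i +
    \sum_(j < n) \sum_(i < n | (j < i)%N) B j i.
  rewrite -big_split; apply: eq_bigr => j _ /=.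
  rewrite (bigID (fun i : 'I_n => (i < j)%N)) /=; congr (_ + _).
  rewrite (bigD1 j) /= ?ltnn // B0 add0r; apply: eq_bigl => i.
  by rewrite -leqNgt ltn_neqAle andbC eq_sym.
rewrite [X in _ + X](exchange_big_dep xpredT) //= -big_split.
apply: eq_bigr => j _ /=.
by rewrite -big_split.
Qed.

(** * Sign factors of words: concatenation, rearrangement, reversal *)

Section EpsTheory.
Variable n : nat.
Implicit Types (q p : 'M[CC]_n) (x y : 'I_n) (s t u v w : seq 'I_n).

(* The contribution to [eps] of an entry x standing before an entry y. *)
Definition cross1 q x y : CC :=
  if x == y then 0 else if (y < x)%N then - q x y else 1.

Definition cross q u v : CC := \prod_(x <- u) \prod_(y <- v) cross1 q x y.

Lemma eps_cons q x s : eps q (x :: s) = \prod_(y <- s) cross1 q x y * eps q s.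
Proof.
rewrite /=; congr (_ * _); case: ifP => xs.
  by rewrite mul0r (big_rem _ xs) /= /cross1 eqxx mul0r.
rewrite mul1r big_mkcond big_seq [RHS]big_seq; apply: eq_bigr => y ys.
by rewrite /cross1; case: eqP => // exy; rewrite exy ys in xs.
Qed.

Lemma eps_cat q u v : eps q (u ++ v) = eps q u * eps q v * cross q u v.
Proof.
elim: u => [|x u IHu]; first by rewrite /cross big_nil mulr1 /= mul1r.
rewrite cat_cons !eps_cons {}IHu /cross big_cons big_cat /= mulrACA -!mulrA.
by congr (_ * _); rewrite mulrCA; congr (_ * _); rewrite mulrCA; congr (_ * _);
  rewrite mulrC.
Qed.

Lemma eps_nuniq q w : ~~ uniq w -> eps q w = 0.
Proof.
elim: w => //= x s IHs; rewrite negb_and negbK => /orP[-> | /IHs ->].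
  by rewrite !mul0r.
by rewrite mulr0.
Qed.

Lemma eps_increasing q w : increasing w -> eps q w = 1.
Proof.
rewrite /increasing; elim: w => // x s IHs.
rewrite /= path_sortedE; last by move=> ? ? ?; apply: ltn_trans.
move=> /andP[/allP xs /IHs ->].
rewrite mulr1; case: ifP => [/xs | _]; first by rewrite ltnn.
rewrite mul1r big_seq_cond big1 // => y /andP[/xs xy].
by rewrite ltnNge ltnW.
Qed.

(** Scalars commute, so the mixed factor in [eps_cat] sees only which letters occur on each side.
    The order inside a block can thus vary freely. *)
Lemma cross_perm q u u' v v' :
  perm_eq u u' -> perm_eq v v' -> cross q u v = cross q u' v'.
Proof.
move=> uu' vv'; rewrite /cross (perm_big _ uu') /=.
by apply: eq_bigr => x _; apply: perm_big.
Qed.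

Lemma eps_nth q w d : eps q w =
  \prod_(a < size w) \prod_(b < size w | (a < b)%N) cross1 q (nth d w a) (nth d w b).
Proof.
elim: w => [|x s IHs]; first by rewrite big_ord0.
rewrite eps_cons big_ord_recl /=; congr (_ * _).
  rewrite [RHS]big_mkcond big_ord_recl /= mul1r (big_nth d) big_mkord.
  by apply: eq_bigr.
rewrite IHs; apply: eq_bigr => a _.
by rewrite [RHS]big_mkcond big_ord_recl /= mul1r [LHS]big_mkcond.
Qed.

Lemma eps_tnth q r (u : r.-tuple 'I_n) : eps q u =
  \prod_(a < r) \prod_(b < r | (a < b)%N) cross1 q (tnth u a) (tnth u b).
Proof.
case: r u => [|r] u; first by rewrite tuple0 big_ord0.
have d := tnth u ord0; rewrite (eps_nth _ _ d) size_tuple.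
by do 2!apply: eq_bigr => ? _; rewrite !(tnth_nth d).
Qed.

Lemma increasing_uniq w : increasing w -> uniq w.
Proof. by apply: sorted_uniq => [? ? ?|?]; [apply: ltn_trans | rewrite ltnn]. Qed.

Lemma enum_ord_increasing : increasing (enum 'I_n).
Proof. by have := iota_ltn_sorted 0 n; rewrite -val_enum_ord sorted_map. Qed.

Lemma compl_increasing s : increasing (compl s).
Proof.
by apply: sorted_filter enum_ord_increasing => ? ? ?; apply: ltn_trans.
Qed.

Lemma mem_compl s x : (x \in compl s) = (x \notin s).
Proof. by rewrite mem_filter mem_enum andbT. Qed.

Lemma perm_compl_cat s : uniq s -> perm_eq (compl s ++ s) (enum 'I_n).
Proof.
move=> us; apply: uniq_perm; rewrite ?enum_uniq //.
  rewrite cat_uniq us increasing_uniq ?compl_increasing // andbT /=.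
  by apply/hasPn => x; rewrite mem_compl negbK.
by move=> x; rewrite mem_cat mem_compl mem_enum orNb.
Qed.

Lemma uniq_perm_enum w : uniq w -> size w = n -> perm_eq w (enum 'I_n).
Proof.
move=> uw sw; apply: uniq_perm; rewrite ?enum_uniq // => x.
have sub : {subset w <= enum 'I_n} by move=> y _; rewrite mem_enum.
by have [|_ ->] := uniq_min_size uw sub; rewrite ?size_enum_ord ?sw.
Qed.

(** For distinct x and y, the ratio between the pair's contribution to [eps p (rev w)] and its
    contribution to [eps (pinv p) w]. On the diagonal both contributions are 0. *)
Definition gpair p x y : CC := if (y < x)%N then - p x y else - p y x.

Lemma gpairC p x y : gpair p x y = gpair p y x.
Proof. by rewrite /gpair; case: ltngtP => // /val_inj ->. Qed.

Fixpoint gprod p w : CC :=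
  if w is x :: s then \prod_(y <- s) gpair p x y * gprod p s else 1.

Lemma gprod_cat p u v : gprod p (u ++ v) =
  gprod p u * gprod p v * \prod_(x <- u) \prod_(y <- v) gpair p x y.
Proof.
elim: u => [|x u IHu]; first by rewrite big_nil mulr1 /= mul1r.
rewrite /= {}IHu big_cons big_cat /= -!mulrA.
by congr (_ * _); rewrite mulrCA; congr (_ * _); rewrite mulrCA; congr (_ * _);
  rewrite mulrC.
Qed.

Lemma gprod_perm p u v : perm_eq u v -> gprod p u = gprod p v.
Proof.
have catC s t : gprod p (s ++ t) = gprod p (t ++ s).
  rewrite !gprod_cat [gprod p s * _]mulrC; congr (_ * _).
  rewrite exchange_big /=; apply: eq_bigr => x _; apply: eq_bigr => y _.
  exact: gpairC.
(* Invariance under all rearrangements reduces to exchanging the first two of three blocks. *)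
apply: catCA_perm_subst => s1 s2 s3.
rewrite !catA !(gprod_cat _ (_ ++ _)) catC; congr (_ * _).
by apply: perm_big; rewrite perm_catC.
Qed.

(* Reversing w exchanges inversions and non-inversions, so up to inverting p the
   two coefficients differ by a product over unordered pairs. *)
Lemma eps_rev_gprod p w : parametric p ->
  eps p (rev w) = gprod p w * eps (pinv p) w.
Proof.
move=> [p0 _]; elim: w => [|x s IHs]; first by rewrite mulr1.
rewrite rev_cons -cats1 eps_cat !eps_cons big_nil [gprod _ _]/= !mulr1 IHs.
rewrite mulrACA mulrC; congr (_ * _).
rewrite -big_split /cross (perm_big s) /= ?perm_rev //.
apply: eq_bigr => y _; rewrite big_seq1 /cross1 /gpair mxE (eq_sym y).
case: (eqVneq x y) => [_|nxy]; first by rewrite mulr0.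
case: ltngtP => [xy|yx|/val_inj e]; last by rewrite e eqxx in nxy.
  by rewrite mulr1.
by rewrite mulrNN mulfV.
Qed.

(** [gprod] agrees on [w] and [s], and [eps (pinv p) s] is 1 as [s] is increasing. This is how the
    inverted matrix p' enters the identity. *)
Lemma eps_rev_perm p w s : parametric p -> increasing s -> perm_eq w s ->
  eps p (rev w) = eps p (rev s) * eps (pinv p) w.
Proof.
move=> pp incs ws; rewrite !eps_rev_gprod // (eps_increasing _ incs) mulr1.
by rewrite (gprod_perm _ ws).
Qed.

End EpsTheory.

(** * Column determinants as sums over words *)

Section CdetWords.
Variables (n : nat) (A : algType CC).

(** Since [I] is increasing, permutations s correspond to rearrangements u of [I] through u_t =
    i_{s(t)}, with the same inversions. In this form determinants match expansions over words term
    by term. *)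
Lemma cdet_words (q : 'M[CC]_n) (X : 'M[A]_n) (I J : seq 'I_n) :
  increasing I -> size J = size I ->
  cdet q X I J = \sum_(u : (size J).-tuple 'I_n | perm_eq u I)
     eps q u *: \prod_(t <- zip u J) X t.1 t.2.
Proof.
move=> incI szJ.
have szI : size I == size J by rewrite szJ.
pose tI : (size J).-tuple 'I_n := Tuple szI.
have tIE d (a : 'I_(size J)) : entry I d a = tnth tI a.
  by rewrite /entry (tnth_nth d).
have tI_inj : injective (tnth tI) by apply/tuple_uniqP; apply: increasing_uniq.
have tI_lt a b : (tnth tI a < tnth tI b)%N = (a < b)%N.
  have d := tnth tI a; rewrite !(tnth_nth d).
  have mono (i j : 'I_(size J)) : (i < j)%N -> (nth d I i < nth d I j)%N.
    move=> ij; apply: (sorted_ltn_nth (leT := fun a b : 'I_n => (a < b)%N)) => //.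
    - by move=> ? ? ?; apply: ltn_trans.
    - by rewrite inE (eqP szI).
    - by rewrite inE (eqP szI).
  case: (ltngtP a b) => [/mono //|/mono ba|/val_inj ->]; last by rewrite ltnn.
  by rewrite ltnNge (ltnW ba).
pose h (s : 'S_(size J)) := [tuple tnth tI (s i) | i < size J].
have h_inj : injective h.
  move=> s1 s2 e; apply/permP => i; apply: tI_inj.
  by have := congr1 (fun u => tnth u i) e; rewrite !tnth_mktuple.
transitivity (\sum_(u in h @: setT) eps q u *: \prod_(t <- zip u J) X t.1 t.2).
  rewrite big_imset /=; last by move=> ? ? _ _; apply: h_inj.
  rewrite /cdet; apply: eq_big => [s|s _]; first by rewrite inE.
  congr (_ *: _).
    change (eps_perm q I s = eps q (h s)).
    rewrite eps_tnth /eps_perm; apply: eq_bigr => a _.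
    rewrite big_mkcondr; apply: eq_bigr => b ab.
    rewrite !tnth_mktuple !tIE /cross1 tI_lt.
    by rewrite (inj_eq tI_inj) (inj_eq perm_inj) -val_eqE (ltn_eqF ab).
  have sz : size (zip (h s) J) = size J by rewrite size_zip size_tuple minnn.
  (* The default index for [nth] is taken from [I], so the empty case is separate. *)
  case: (posnP (size J)) => [J0|Jgt0].
    rewrite big1 => [|a]; last by have := ltn_ord a; rewrite {2}J0.
    by have /= -> := size0nil (etrans sz J0); rewrite big_nil.
  have d := tnth tI (Ordinal Jgt0).
  rewrite (big_nth (d, d)) sz big_mkord; apply: eq_bigr => a _.
  have /= hsE : nth d (h s) a = tnth tI (s a) by rewrite -tnth_nth tnth_mktuple.
  rewrite nth_zip; last exact: size_tuple (h s).
  by rewrite /= hsE tIE (tnth_nth d (in_tuple J)).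
apply: eq_bigl => u; apply/imsetP/idP => [[s _ ->]|uI].
  by change (perm_eq (h s) tI); apply/tuple_permP; exists s.
have /tuple_permP[s us] : perm_eq u tI by [].
by exists s => //; apply: val_inj.
Qed.

End CdetWords.

(** * Reordering words in operators that obey Grassmann relations *)

Section WordAction.
Variables (n : nat) (V : lmodType CC).
Implicit Type T : 'I_n -> V -> V.

(** The first letter acts first: if each [T i] is right multiplication by t_i, then [w] acts as
    right multiplication by t_{w_1} t_{w_2} and so on. *)
Definition wact T (w : seq 'I_n) (v : V) : V := foldl (fun v i => T i v) v w.

Lemma wact_cat T u w v : wact T (u ++ w) v = wact T w (wact T u v).
Proof. exact: foldl_cat. Qed.

Lemma wact_rcons T w x v : wact T (rcons w x) v = T x (wact T w v).
Proof. exact: foldl_rcons. Qed.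

Variables (p : 'M[CC]_n) (T : 'I_n -> V -> V).
Hypothesis T_scale : forall k a v, T k (a *: v) = a *: T k v.
(** At y = x the factor is 0, so the vanishing of squares is included. *)
Hypothesis T_swap : forall (x y : 'I_n) v, (y <= x)%N ->
  T y (T x v) = cross1 p x y *: T x (T y v).

Let leo : rel 'I_n := fun a b => (a <= b)%N.

Lemma wact_scale w a v : wact T w (a *: v) = a *: wact T w v.
Proof. by elim: w v => //= x s IHs v; rewrite T_scale IHs. Qed.

(** One round of insertion sort: x passes each y at most x at the cost [cross1 p x y]; the entries
    beyond its final place are larger and have factor 1. *)
Lemma wact_insert x t : sorted leo t ->
  exists t', [/\ sorted leo t', perm_eq t' (x :: t) &
    forall v, wact T (x :: t) v = \prod_(y <- t) cross1 p x y *: wact T t' v].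
Proof.
elim: t => [|y t IHt] sy.
  by exists [:: x]; split => // v; rewrite big_nil scale1r.
have leo_trans : transitive leo by move=> ? ? ?; apply: leq_trans.
move: (sy); rewrite /= path_sortedE // => /andP[/allP yt st].
case: (ltnP x y) => [xy|yx].
  exists (x :: y :: t); split => //; first by rewrite /= (ltnW xy : leo x y).
  move=> v; rewrite big_seq big1 ?scale1r // => z zyt.
  have xz : (x < z)%N.
    by move: zyt; rewrite inE => /predU1P[-> //|/yt]; apply: leq_trans.
  by rewrite /cross1 -val_eqE (ltn_eqF xz) ltnNge (ltnW xz).
have [t' [st' pt' wt']] := IHt st.
exists (y :: t'); split.
- rewrite /= path_sortedE // st' andbT (perm_all _ pt') /=.
  by apply/andP; split; [exact: yx | apply/allP].
- move: pt'; rewrite -(perm_cons y) => /perm_trans -> //.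
  by rewrite (perm_catCA [:: y] [:: x]).
- by move=> v; rewrite big_cons -scalerA -wt' -wact_scale /= (T_swap v yx) T_scale.
Qed.

Lemma wact_sort w : exists t, [/\ sorted leo t, perm_eq t w &
  forall v, wact T w v = eps p w *: wact T t v].
Proof.
elim: w => [|x s [t [st pt wt]]].
  by exists [::]; split => // v; rewrite scale1r.
have [t' [st' pt' wt']] := wact_insert x st.
exists t'; split => // [|v]; first by rewrite (perm_trans pt') // perm_cons.
rewrite eps_cons (perm_big t) 1?perm_sym //= mulrC -scalerA -wt' /=.
exact: wt.
Qed.

(** Sorting costs [eps p w]. A word of length n either repeats a letter, which makes this factor 0,
    or contains every index once and sorts to [enum 'I_n]. *)
Lemma wact_full w v : size w = n ->
  wact T w v = eps p w *: wact T (enum 'I_n) v.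
Proof.
move=> sw; have [uw|/eps_nuniq w0] := boolP (uniq w); last first.
  by have [t [_ _ ->]] := wact_sort w; rewrite w0 !scale0r.
have [t [st pt ->]] := wact_sort w; congr (_ *: wact _ _ _).
apply: (sorted_eq (leT := leo)) => //.
- by move=> ? ? ?; apply: leq_trans.
- by move=> a b /anti_leq /val_inj.
- apply: sub_sorted (enum_ord_increasing n) => a b; exact: ltnW.
- by rewrite (perm_trans pt) // uniq_perm_enum.
Qed.

End WordAction.

(** * The q-Grassmann algebra through right multiplications *)

Section Grassmann.
Variables (n : nat) (A : algType CC) (q p : 'M[CC]_n).

(* The value at S is the coefficient of the ordered monomial psi_S. *)
Local Notation V := {ffun {set 'I_n} -> A}.

Definition rmul (v : V) (a : A) : V := [ffun S => v S * a].

(** Right multiplication by psi_i: the scalar is the cost of moving psi_i from the right end to its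
    place, past all larger s. *)
Definition psi (i : 'I_n) (v : V) : V :=
  [ffun S : {set 'I_n} => if i \in S
     then \prod_(s in S :\ i) cross1 q s i *: v (S :\ i) else 0].

(** Right multiplication by phi_k. Entries of [M] accumulate on the right, in the order a column
    determinant requires. *)
Definition phi (M : 'M[A]_n) (k : 'I_n) (v : V) : V :=
  \sum_i rmul (psi i v) (M i k).

(** The monomial psi_S; [delta set0] is the unit of the algebra. *)
Definition delta (S : {set 'I_n}) : V := [ffun S' => (S' == S)%:R].

Lemma psi_is_linear i : linear (psi i).
Proof.
move=> a u v; apply/ffunP => S; rewrite !ffunE; case: ifP => _.
  by rewrite scalerDr !scalerA mulrC.
by rewrite scaler0 addr0.
Qed.

HB.instance Definition _ i :=
  GRing.isLinear.Build CC V V _ (psi i) (psi_is_linear i).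

Lemma rmul_sum (T : Type) (r : seq T) (P : pred T) (F : T -> V) a :
  rmul (\sum_(i <- r | P i) F i) a = \sum_(i <- r | P i) rmul (F i) a.
Proof.
elim/big_rec2: _ => [|i u v _ <-].
  by apply/ffunP => S; rewrite !ffunE mul0r.
by apply/ffunP => S; rewrite !ffunE mulrDl.
Qed.

Lemma rmulZ b v a : rmul (b *: v) a = b *: rmul v a.
Proof. by apply/ffunP => S; rewrite !ffunE scalerAl. Qed.

Lemma rmulZr b v a : rmul v (b *: a) = b *: rmul v a.
Proof. by apply/ffunP => S; rewrite !ffunE scalerAr. Qed.

Lemma rmulDr v a b : rmul v (a + b) = rmul v a + rmul v b.
Proof. by apply/ffunP => S; rewrite !ffunE mulrDr. Qed.

Lemma rmul_sumr v (F : 'I_n -> A) : rmul v (\sum_i F i) = \sum_i rmul v (F i).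
Proof.
apply/ffunP => S; rewrite ffunE sum_ffunE mulr_sumr.
by under [RHS]eq_bigr do rewrite ffunE.
Qed.

Lemma rmulA v a b : rmul (rmul v a) b = rmul v (a * b).
Proof. by apply/ffunP => S; rewrite !ffunE mulrA. Qed.

Lemma rmul1 v : rmul v 1 = v.
Proof. by apply/ffunP => S; rewrite !ffunE mulr1. Qed.

Lemma rmul0r v : rmul v 0 = 0.
Proof. by apply/ffunP => S; rewrite !ffunE mulr0. Qed.

Lemma rmul0 a : rmul 0 a = 0.
Proof. by apply/ffunP => S; rewrite !ffunE mul0r. Qed.

Lemma psi_rmul i v a : psi i (rmul v a) = rmul (psi i v) a.
Proof.
by apply/ffunP => S; rewrite !ffunE; case: ifP => _; rewrite ?mul0r // scalerAl.
Qed.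

Lemma psi_psi i v : psi i (psi i v) = 0.
Proof.
by apply/ffunP => S; rewrite !ffunE setD11 scaler0; case: ifP.
Qed.

Lemma psi_swap (i j : 'I_n) v : (i < j)%N ->
  psi i (psi j v) = - q j i *: psi j (psi i v).
Proof.
move=> ij; have ji : j != i by rewrite -val_eqE (gtn_eqF ij).
apply/ffunP => S; rewrite !ffunE !in_setD1 ji (eq_sym i) ji /=.
case: ifP => iS; case: ifP => jS; rewrite ?scaler0 //.
rewrite !scalerA setDDl setUC -setDDl; congr (_ *: _).
(* The two sides differ in one factor each: j in the first product gives [- q j i], i in the other
   gives 1. *)
rewrite (bigD1 j) /=; last by rewrite in_setD1 ji.
rewrite [X in _ = _ * (X * _)](bigD1 i) /=; last by rewrite in_setD1 eq_sym ji.
rewrite {1}/cross1 (negbTE ji) ij.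
rewrite {3}/cross1 (eq_sym i) (negbTE ji) ltnNge (ltnW ij) /= mul1r.
rewrite -!mulrA; congr (_ * _); rewrite mulrC; congr (_ * _).
  by apply: eq_bigl => s; rewrite !in_setD1 andbC.
by apply: eq_bigl => s; rewrite !in_setD1 -andbA [(s \in S) && _]andbC.
Qed.

Lemma psi_delta i S :
  psi i (delta S) = \prod_(s in S) cross1 q s i *: delta (i |: S).
Proof.
apply/ffunP => S'; rewrite !ffunE.
have [iS|niS] := boolP (i \in S).
  rewrite [X in _ = X *: _](bigD1 i) //= {2}/cross1 eqxx mul0r scale0r.
  case: ifP => // _.
  have -> : (S' :\ i == S) = false.
    by apply/eqP => e; move: iS; rewrite -e setD11.
  by rewrite scaler0.
have [iS'|niS'] := boolP (i \in S'); last first.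
  have -> : (S' == i |: S) = false.
    by apply/eqP => e; move: niS'; rewrite e setU11.
  by rewrite scaler0.
have [e|ne] := eqVneq (S' :\ i) S.
  by rewrite -e setD1K // eqxx.
have -> : (S' == i |: S) = false.
  by apply/eqP => e; move: ne; rewrite e setU1K // eqxx.
by rewrite !scaler0.
Qed.

Lemma wact_psi_delta w :
  wact psi w (delta set0) = eps q w *: delta [set x in w].
Proof.
elim/last_ind: w => [|w x IHw].
  by rewrite /= scale1r; congr delta; apply/setP => x; rewrite !inE.
rewrite wact_rcons {}IHw linearZ /= psi_delta scalerA -cats1 eps_cat eps_cons.
rewrite big_nil /= !mulr1.
have [uw|/(eps_nuniq q) ->] := boolP (uniq w); last by rewrite !mul0r !scale0r.
congr (_ * _ *: delta _); last by apply/setP => y; rewrite !inE mem_cat inE orbC.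
rewrite /cross big_uniq //=; apply: eq_big => s; first by rewrite inE.
by rewrite big_seq1.
Qed.

(** * The elements phi_k of a Manin matrix *)

Variables M Minv : 'M[A]_n.

Lemma phi_scale k a v : phi M k (a *: v) = a *: phi M k v.
Proof.
rewrite /phi scaler_sumr; apply: eq_bigr => i _.
by rewrite linearZ /= rmulZ.
Qed.

Hypothesis manin_M : manin q p M.
Hypothesis p_param : parametric p.

(** Squares of the psi's vanish, and [psi_swap] merges the two orders of each pair, leaving
    coefficients to which the Manin relations apply. *)
Lemma phi_phi x y v : phi M y (phi M x v) =
  \sum_(j < n) \sum_(i < n | (i < j)%N) rmul (psi j (psi i v))
     (M i x * M j y - q j i *: (M j x * M i y)).
Proof.
transitivity (\sum_j \sum_i rmul (psi j (psi i v)) (M i x * M j y)).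
  apply: eq_bigr => j _; rewrite linear_sum rmul_sum; apply: eq_bigr => i _.
  by rewrite /= psi_rmul rmulA.
rewrite sum_antidiag => [|i]; last by rewrite psi_psi rmul0.
apply: eq_bigr => j _; apply: eq_bigr => i ij.
by rewrite (psi_swap v ij) rmulDr -scaleNr rmulZ rmulZr.
Qed.

(** By [phi_phi] coefficients can be compared pair by pair: the first Manin relation settles x = y,
    the second, with columns y < x, the rest. *)
Lemma phi_swap (x y : 'I_n) v : (y <= x)%N ->
  phi M y (phi M x v) = cross1 p x y *: phi M x (phi M y v).
Proof.
case: manin_M => M1 M2; case: p_param => [_ [pp _]].
rewrite !phi_phi scaler_sumr => yx; apply: eq_bigr => j _.
rewrite scaler_sumr; apply: eq_bigr => i ij.
rewrite /cross1; case: (eqVneq x y) => [->|nxy].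
  by rewrite M1 // subrr rmul0r scale0r.
have {}yx : (y < x)%N by rewrite ltn_neqAle yx andbT eq_sym.
rewrite yx -rmulZr; congr rmul.
(* Multiplying by p_xy, the inverse of p_yx, frees the two middle terms of p. *)
have := congr1 (fun a => p x y *: a) (M2 i j y x ij yx).
rewrite scaler0 !scalerDr !scalerN !scalerA pp mulrCA pp mulr1 scale1r => e.
apply/eqP; rewrite -subr_eq0 -e; apply/eqP.
rewrite mulNr !scaleNr opprK opprD opprK addrA; congr (_ - _).
by rewrite addrAC [_ + p x y *: _]addrC addrAC.
Qed.

Lemma wact_psi_sum (T : finType) (F : T -> V) (a : T -> A) s :
  wact psi s (\sum_i rmul (F i) (a i)) = \sum_i rmul (wact psi s (F i)) (a i).
Proof.
elim: s F => //= x s IHs F; rewrite linear_sum /= -IHs; congr (wact _ _ _).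
by apply: eq_bigr => i _; rewrite psi_rmul.
Qed.

Lemma wact_phi_words w v : wact (phi M) w v =
  \sum_(u : (size w).-tuple 'I_n)
     rmul (wact psi u v) (\prod_(t <- zip u w) M t.1 t.2).
Proof.
elim: w v => [|k w IHw] v.
  rewrite (big_tuple0 _ (fun u => rmul (wact psi u v)
    (\prod_(t <- zip u [::]) M t.1 t.2))).
  by rewrite big_nil rmul1.
rewrite (big_tuple_cons _ _ (fun u => rmul (wact psi u v)
  (\prod_(t <- zip u (k :: w)) M t.1 t.2))).
rewrite /= IHw exchange_big /=; apply: eq_bigr => u _.
rewrite wact_psi_sum rmul_sum; apply: eq_bigr => i _.
by rewrite big_cons rmulA.
Qed.

(** The total degree is n, so a word [u ++ s] without repetition uses every index and gives the top
    monomial; the other words have [eps] equal to 0. *)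
Lemma wact_psi_phi_top s w : (size w + size s = n)%N ->
  wact psi s (wact (phi M) w (delta set0)) setT =
  \sum_(u : (size w).-tuple 'I_n)
     eps q (u ++ s) *: \prod_(t <- zip u w) M t.1 t.2.
Proof.
move=> sz; rewrite wact_phi_words wact_psi_sum sum_ffunE; apply: eq_bigr => u _.
rewrite ffunE -wact_cat wact_psi_delta !ffunE.
have [us|/(eps_nuniq q) ->] := boolP (uniq (u ++ s)); last by rewrite !scale0r mul0r.
have /uniq_perm_enum pe : uniq (u ++ s) by [].
have -> : [set x in u ++ s] = setT.
  apply/setP => x; rewrite !inE (perm_mem (pe _)) ?mem_enum //.
  by rewrite size_cat size_tuple.
by rewrite eqxx -scalerAl mul1r.
Qed.

(** * Expressing the psi's through the phi's *)

Hypothesis MMinv : M *m Minv = 1%:M.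

Lemma psi_phi j v : psi j v = \sum_i rmul (phi M i v) (Minv i j).
Proof.
under eq_bigr => i _ do rewrite rmul_sum.
(* The coefficient of psi_l is the (l, j) entry of the product of [M] and [Minv], so only l = j
   survives. *)
rewrite exchange_big /= (bigD1 j) //= [X in _ + X]big1 => [|l lj].
  under eq_bigr => i _ do rewrite rmulA.
  have := congr1 (fun X : 'M_n => X j j) MMinv; rewrite !mxE eqxx => e.
  by rewrite -rmul_sumr e rmul1 addr0.
under eq_bigr => i _ do rewrite rmulA.
have := congr1 (fun X : 'M_n => X l j) MMinv; rewrite !mxE (negbTE lj) => e.
by rewrite -rmul_sumr e rmul0r.
Qed.

(** A psi commutes with coefficients, unlike a phi, so each psi_j is moved past the coefficients
    already produced before it is expanded. Its new coefficient lands to their left, so the entries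
    of [Minv] follow the order of [J] while the letters are reversed. *)
Lemma wact_psi_rev_words J v : wact psi (rev J) v =
  \sum_(w : (size J).-tuple 'I_n)
     rmul (wact (phi M) (rev w) v) (\prod_(t <- zip w J) Minv t.1 t.2).
Proof.
elim: J => [|j J IHJ].
  by rewrite (big_tuple0 _ (fun w => rmul (wact (phi M) (rev w) v)
    (\prod_(t <- zip w [::]) Minv t.1 t.2))) big_nil rmul1.
rewrite (big_tuple_cons _ _ (fun w => rmul (wact (phi M) (rev w) v)
  (\prod_(t <- zip w (j :: J)) Minv t.1 t.2))).
rewrite rev_cons wact_rcons IHJ exchange_big linear_sum; apply: eq_bigr => w _ /=.
rewrite psi_rmul psi_phi rmul_sum; apply: eq_bigr => i _.
by rewrite big_cons rmulA rev_cons wact_rcons.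
Qed.

End Grassmann.

(** * Comparison of the two expansions *)

Theorem mainTheorem8 (n : nat) (A : algType CC) (q p : 'M[CC]_n)
    (M Minv : 'M[A]_n) (I J : seq 'I_n) :
  parametric q -> parametric p -> manin q p M ->
  M *m Minv = 1%:M -> Minv *m M = 1%:M ->
  increasing I -> size J = size I ->
  eps p (compl I ++ rev I) *: (cdet_full q M * cdet (pinv p) Minv I J)
  = (if uniq J then eps q (compl J ++ rev J) *: cdet q M (compl J) (compl I)
     else 0).
Proof.
move=> _ pp mM MN _ incI szJ.
have size_compl (s : seq 'I_n) : uniq s -> (size (compl s) + size s = n)%N.
  by move=> /perm_compl_cat /perm_size; rewrite size_cat size_enum_ord.
have perm_top (u s : seq 'I_n) : size u = size (compl s) -> uniq s ->
    uniq (u ++ rev s) -> perm_eq u (compl s).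
  move=> su us uus; rewrite -(perm_cat2r (rev s)).
  rewrite (perm_trans (uniq_perm_enum uus _)) ?size_cat ?size_rev ?su ?size_compl //.
  by rewrite perm_sym (perm_trans _ (perm_compl_cat us)) // perm_cat2l perm_rev.
have uI := increasing_uniq incI.
have szc : (size (compl I) + size J = n)%N by rewrite szJ size_compl.
have top_full : wact (phi q M) (enum 'I_n) (delta A set0) setT = cdet_full q M.
  have /= -> := @wact_psi_phi_top n A q M [::] (enum 'I_n); last first.
    by rewrite addn0 size_enum_ord.
  rewrite /cdet_full cdet_words ?enum_ord_increasing // [RHS]big_mkcond /=.
  apply: eq_bigr => u _; rewrite cats0; case: ifP => // npu.
  rewrite eps_nuniq ?scale0r //; apply: contraFN npu => uu.
  by rewrite uniq_perm_enum // size_tuple size_enum_ord.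
transitivity (wact (psi q) (rev J) (wact (phi q M) (compl I) (delta A set0)) setT).
  rewrite (wact_psi_rev_words _ MN) sum_ffunE cdet_words // mulr_sumr scaler_sumr.
  rewrite big_mkcond; apply: eq_bigr => w _ /=; rewrite ffunE -wact_cat.
  have szw : size (compl I ++ rev w) = n by rewrite size_cat size_rev size_tuple.
  (* Each phi word has length n and sorts to phi_1 ... phi_n, whose top coefficient is
     [cdet_full q M]. *)
  rewrite (wact_full (phi_scale q M) (phi_swap mM pp)) // !ffunE top_full.
  rewrite -scalerAl; case: ifP => [pw|npw].
    rewrite -scalerAr scalerA; congr (_ *: _).
    (* The only dependence on the order of [w] is the factor [eps (pinv p) w], the coefficient in
       the determinant of [Minv]. *)
    rewrite !eps_cat (eps_rev_perm pp incI pw).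
    have -> : cross p (compl I) (rev w) = cross p (compl I) (rev I).
      by apply: cross_perm => //; rewrite perm_rev perm_sym perm_rev perm_sym.
    by rewrite mulrAC !mulrA.
  (* If [w] does not rearrange [I], then [compl I ++ rev w] repeats a letter. *)
  rewrite eps_nuniq ?scale0r //; apply: contraFN npw => uw.
  have := perm_trans (uniq_perm_enum uw szw).
  move=> /(_ (compl I ++ I)); rewrite perm_sym perm_compl_cat // => /(_ isT).
  by rewrite perm_cat2l perm_rev.
rewrite wact_psi_phi_top ?size_rev //.
case: ifP => [uJ|nuJ]; last first.
  apply: big1 => u _; rewrite eps_nuniq ?scale0r // cat_uniq rev_uniq nuJ.
  by rewrite !andbF.
have szcc : size (compl I) = size (compl J).
  by apply/eqP; rewrite -(eqn_add2r (size J)) szc size_compl.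
rewrite cdet_words ?compl_increasing // scaler_sumr [RHS]big_mkcond /=.
apply: eq_bigr => u _; case: ifP => [pu|npu].
  (* Since u rearranges [compl J], whose own [eps] is 1, the sign of [u ++ rev J] is [eps q u] times
     that of [compl J ++ rev J]. *)
  rewrite scalerA; congr (_ *: _); rewrite !eps_cat.
  rewrite (cross_perm q pu (perm_refl _)) (eps_increasing _ (compl_increasing J)).
  by rewrite mul1r [RHS]mulrC mulrA.
rewrite eps_nuniq ?scale0r //; apply: contraFN npu => uu.
by rewrite perm_top // size_tuple.
Qed.
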